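(* Let $D$ be an eulerian digraph in which the set $S$ of vertices with degree congruent to $0$ mod $4$ has $|S|=2n$. Suppose there exists a $4$-regular digraph $H$ with $2n$ vertices having a bi-eulerian directed embedding whose two faces are bounded by directed euler circuits $X_1$ and $X_2$. Let $\xi$ range over the cyclic vertex sequences of $X_1$, of $X_2$, and of their reverses. If $T$ is a directed euler circuit of $D$ whose cyclic vertex sequence has a subsequence $\gamma$ that contains each vertex of $S$ exactly twice (and no other entries) and is patterned by at least one of the choices for $\xi$, then $D$ has a bi-eulerian directed embedding (necessarily orientable) with one of the faces bounded by $T$.
   Context: Digraphs are finite and may have loops and multiple arcs; the degree of a vertex is its total degree. A $4$-regular digraph has indegree $2$ and outdegree $2$ at every vertex. A digraph is eulerian if it has a directed circuit using every arc and every vertex (a directed euler circuit). Embeddings are cellular in closed surfaces; a directed embedding has every face bounded by a directed closed walk; a bi-eulerian directed embedding has exactly two faces, each bounded by a directed euler circuit. If $\tau$ is a (cyclic) sequence of length $N$ on $M$ distinct symbols, a (cyclic) sequence $\gamma$ is patterned by $\tau$ if $\gamma$ also has length $N$ and $M$ distinct symbols and there is a bijection $g$ from the symbols of $\tau$ to those of $\gamma$ such that applying $g$ to each position of $\tau$ yields $\gamma$. *)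

(* Defs.v *)
From mathcomp Require Import all_boot.

Set Implicit Arguments.
Unset Strict Implicit.
Unset Printing Implicit Defensive.

(* Finite digraphs; loops and multiple arcs are allowed. *)
Record digraph := Digraph {
  dvert : finType;
  darc : finType;
  dtail : darc -> dvert;
  dhead : darc -> dvert
}.

Section Digraphs.
Variable D : digraph.

Definition outdeg (v : dvert D) : nat := #|[set a : darc D | dtail a == v]|.
Definition indeg (v : dvert D) : nat := #|[set a : darc D | dhead a == v]|.
Definition degree (v : dvert D) : nat := outdeg v + indeg v.

Definition four_regular : Prop :=
  forall v : dvert D, outdeg v = 2 /\ indeg v = 2.

Definition mod4_vertices : {set dvert D} :=
  [set v | degree v == 0 %[mod 4]].

Definition adjacent : rel (dvert D) := fun u v =>
  [exists a : darc D, ((dtail a == u) && (dhead a == v))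
                   || ((dtail a == v) && (dhead a == u))].

Definition connected_digraph : Prop :=
  forall u v : dvert D, connect adjacent u v.

(* A closed walk is given by its cyclic sequence of arcs, as a list whose
   starting point is irrelevant. *)
Definition directed_closed_walk (W : seq (darc D)) : Prop :=
  W <> [::] /\ cycle (fun a b : darc D => dhead a == dtail b) W.

Definition vertex_seq (W : seq (darc D)) : seq (dvert D) :=
  [seq dtail a | a <- W].

Definition directed_euler_circuit (W : seq (darc D)) : Prop :=
  [/\ directed_closed_walk W, uniq W,
      forall a : darc D, a \in W
    & forall v : dvert D, v \in vertex_seq W].

Definition eulerian : Prop :=
  exists W : seq (darc D), directed_euler_circuit W.

End Digraphs.

Definition cyclic_eq (T : eqType) (s t : seq T) : Prop :=
  exists k : nat, t = rot k s.

Definition cyclic_subseq (T : eqType) (s t : seq T) : Prop :=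
  exists k : nat, subseq s (rot k t).

Definition patterned_by (T U : eqType) (gamma : seq U) (tau : seq T) : Prop :=
  [/\ size gamma = size tau,
      size (undup gamma) = size (undup tau)
    & exists g : T -> U,
        [/\ {in tau &, injective g},
            map g tau =i gamma
          & cyclic_eq (map g tau) gamma]].

(* Cellular embeddings in closed surfaces, orientable or not, are encoded by
   flags.  Each arc has four flags (a, e, s): e is the end of a (true for the
   tail, false for the head), and s is one of the two sides of a, taken
   consistently along the whole of a.  The surface is determined by the face
   corners: each corner at a vertex lies between two consecutive arc ends, and
   joins one flag of the first with one flag of the second. *)
Section Flags.
Variable D : digraph.

Definition flag : finType := (darc D * bool * bool)%type.

Definition flag_arc (x : flag) : darc D := x.1.1.
Definition at_tail (x : flag) : bool := x.1.2.
Definition flag_vert (x : flag) : dvert D :=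
  if at_tail x then dtail (flag_arc x) else dhead (flag_arc x).

Definition along (x : flag) : flag := (x.1.1, ~~ x.1.2, x.2).
Definition across (x : flag) : flag := (x.1.1, x.1.2, ~~ x.2).

End Flags.

(* [corner_single] says that the flags at a vertex form a single cyclic
   rotation, so that the vertex has a disk neighbourhood.  Connectedness of
   the digraph is that of the surface.  An edgeless digraph has no flags, and
   its embedding in the sphere is not represented properly. *)
Record embedding (D : digraph) := Embedding {
  corner : flag D -> flag D;
  corner_invol : forall x, corner (corner x) = x;
  corner_neq : forall x, corner x <> x;
  corner_vert : forall x, flag_vert (corner x) = flag_vert x;
  corner_single : forall x y, flag_vert x = flag_vert y ->
    connect (fun u v => (v == corner u) || (v == across u)) x y;
  embedding_connected : connected_digraph D
}.

Section Embeddings.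
Variables (D : digraph) (E : embedding D).

Definition face_of (x : flag D) : {set flag D} :=
  [set y | connect (fun u v => (v == corner E u) || (v == along u)) x y].

Definition faces : {set {set flag D}} := [set face_of x | x : flag D].

(* From x, traverse the arc of x away from the end at x, then turn at the
   corner there. *)
Definition face_step (x : flag D) : flag D := corner E (along x).

(* The iterates of [face_step] from a flag of F trace the boundary of F in one
   of its two directions. *)
Definition bounded_by (F : {set flag D}) (W : seq (darc D)) : Prop :=
  exists x : flag D,
    [/\ x \in F,
        all (@at_tail D) (orbit face_step x)
      & cyclic_eq (map (@flag_arc D) (orbit face_step x)) W].

Definition directed_embedding : Prop :=
  forall F, F \in faces ->
    exists W, directed_closed_walk W /\ bounded_by F W.

Definition bi_eulerian : Prop :=
  [/\ directed_embedding,
      #|faces| = 2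
    & forall F, F \in faces ->
        exists X, directed_euler_circuit X /\ bounded_by F X].

Definition orientable : Prop :=
  exists o : flag D -> bool, forall x,
    [/\ o (corner E x) = ~~ o x, o (along x) = ~~ o x
      & o (across x) = ~~ o x].

End Embeddings.

(* Main.v *)
Require Import Defs.
From mathcomp Require Import all_boot.
From mathcomp Require Import fingroup perm.

(* Let t send each arc to its successor on T.  An orientable bi-eulerian
   embedding with T as a face amounts to a permutation pi of the arcs whose
   cycles are exactly the classes of arcs with a common tail, and such that
   t pi is again a single cycle; that cycle bounds the other face.
   If a single cycle is multiplied by a transposition (a b) it splits in two,
   separating a from b, so a third point p is separated from a or from b, and
   one of (p a), (p b) joins the pieces again: for each triple one of the two
   3-cycles preserves single cycles.  Starting from one arc of each class,
   3-cycles through that arc absorb the rest of the class two arcs at a time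
   when it has odd size.  For the classes of even size, i.e. the vertices of S,
   one starts from the transposition of the two arcs selected by gamma.  All
   these transpositions together keep T a single cycle because in H swapping
   the two arcs leaving every vertex turns X1 into X2. *)

Set Implicit Arguments.
Unset Strict Implicit.
Unset Printing Implicit Defensive.

Import GroupScope.

(** * Single cycles multiplied by 3-cycles inside prescribed classes *)

Section Permutations.
Variable T : finType.
Implicit Types (s u : {perm T}) (x y z : T).

Definition single_cycle s := forall x y, y \in porbit s x.

Lemma porbit_trans s x y z :
  y \in porbit s x -> z \in porbit s y -> z \in porbit s x.
Proof. by rewrite -eq_porbit_mem => /eqP ->. Qed.

Lemma porbit_step s x : s x \in porbit s x.
Proof. by rewrite -{1}[s]expg1 mem_porbit. Qed.

Lemma porbit_ind s (P : T -> Prop) x :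
    P x -> (forall y, y \in porbit s x -> P y -> P (s y)) ->
  forall y, y \in porbit s x -> P y.
Proof.
move=> Px Ps y /porbitP[i ->]; elim: i => [|i IHi]; first by rewrite perm1.
by rewrite expgSr permM; apply: Ps IHi; apply: mem_porbit.
Qed.

Lemma porbit_fixed s x y : s x = x -> y \in porbit s x -> y = x.
Proof. by move=> sx; elim/(@porbit_ind s) => // z _ ->. Qed.

Lemma card_porbits1P s :
  0 < #|T| -> #|porbits s| = 1%N <-> single_cycle s.
Proof.
move=> /card_gt0P[x0 _]; split=> [/eqP/cards1P[O sO] x y | s1].
  have memO z : porbit s z = O by apply/set1P; rewrite -sO imset_f.
  by rewrite memO -(memO y) porbit_id.
apply/eqP/cards1P; exists (porbit s x0); apply/setP=> O; rewrite inE.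
apply/imsetP/eqP => [[x _ ->] | ->]; last by exists x0.
by apply/eqP; rewrite eq_porbit_mem.
Qed.

(** The product [tperm a b * s] has two cycles, with [a] and [b] in different ones. The point [p]
    misses the cycle of [a] or that of [b], and transposing it with that point merges the two cycles
    again. *)
Lemma single_cycle_3cycle s (p a b : T) : p != a -> p != b -> a != b ->
    single_cycle s ->
  single_cycle (tperm p a * (tperm a b * s)) \/
  single_cycle (tperm p b * (tperm b a * s)).
Proof.
move=> pa pb ab s1; have T0 : 0 < #|T| by apply/card_gt0P; exists p.
(* Cycles are counted with [porbits_mul_tperm]: a transposition of points in different cycles lowers
   the count by one, and one within a cycle raises it by one. *)
have merge u c : p != c -> #|porbits u| = 2 -> p \notin porbit u c ->
  single_cycle (tperm p c * u).
  move=> pc u2 uc; apply/card_porbits1P => //.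
  have := porbits_mul_tperm u p c; rewrite /= u2 uc pc => u3.
  exact: (@addIn 2).
rewrite (tpermC b a); set u := tperm a b * s.
have [u2 uab] : #|porbits u| = 2 /\ a \notin porbit u b.
  have s2 : #|porbits s| = 1%N by apply/card_porbits1P.
  have := porbits_mul_tperm s a b; rewrite -/u /= s2 ab s1 /= addn0 => u2.
  split=> //; have := porbits_mul_tperm u a b.
  by rewrite /= u2 ab /u mulgA tperm2 mul1g s2; case: (_ \notin _).
have [pua | pua] := boolP (p \in porbit u a); last by left; apply: merge.
right; apply: merge => //; apply: contra uab => pub.
by apply: porbit_trans pub _; rewrite porbit_sym.
Qed.

Section Extension.
Variables (V : finType) (c : T -> V) (p : V -> T).
Hypothesis pK : cancel p c.

(** The map [c] gives the class of a point and [p] a base point of each class. These are the points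
    not yet absorbed into the cycle of [u] through the base point of their class. *)
Definition off u := [set x | x \notin porbit u (p (c x))].

(** Products act from left to right, so [u'] sends [p v] to [b], [b] to [a], and [a] to the old
    image [u (p v)]. The fixed points [b] and [a] are thus spliced into the base cycle right after
    [p v], and all other points keep their images. *)
Lemma insert_3cycle u v (a b : T) :
    (forall x, c (u x) = c x) -> (forall x, x \in off u -> u x = x) ->
    a \in off u -> b \in off u -> c a = v -> c b = v -> a != b ->
    let u' := tperm (p v) a * (tperm a b * u) in
  [/\ forall x, c (u' x) = c x, off u' = off u :\: [set a; b]
    & forall x, x \in off u' -> u' x = x].
Proof.
move=> cu ufix offa offb ca cb ab u'.
have ua : u a = a by apply: ufix.
have ub : u b = b by apply: ufix.
have on_p w : p w \in porbit u (p w) by apply: porbit_id.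
have notoff w : p w \notin off u by rewrite inE pK negbK.
have pa : p v != a by apply: contraNneq (notoff v) => ->.
have pb : p v != b by apply: contraNneq (notoff v) => ->.
have u'p : u' (p v) = b by rewrite !permM tpermL tpermL.
have u'b : u' b = a by rewrite !permM (tpermD pb ab) tpermR.
have u'a : u' a = u (p v).
  by rewrite !permM tpermR tpermD // eq_sym.
have u'D x : x != p v -> x != a -> x != b -> u' x = u x.
  by move=> xp xa xb; rewrite !permM !tpermD // eq_sym.
have cu' x : c (u' x) = c x.
  have [->|xp] := eqVneq x (p v); first by rewrite u'p pK.
  have [->|xa] := eqVneq x a; first by rewrite u'a cu pK.
  have [->|xb] := eqVneq x b; first by rewrite u'b ca cb.
  by rewrite u'D.
have b_on : b \in porbit u' (p v) by rewrite -u'p porbit_step.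
have a_on : a \in porbit u' (p v).
  by apply: porbit_trans b_on _; rewrite -u'b porbit_step.
have cp w y : y \in porbit u (p w) -> c y = w.
  by elim/(@porbit_ind u) => [|z _]; rewrite ?pK ?cu.
have on_on w x : x \in porbit u (p w) -> x \in porbit u' (p w).
  elim/(@porbit_ind u) => [|y yw yw']; first exact: porbit_id.
  have [ay|ya] := eqVneq y a.
    by rewrite ay ua -ay.
  have [by_|yb] := eqVneq y b; first by rewrite by_ ub -by_.
  have [yp|yp] := eqVneq y (p v).
    rewrite yp -u'a; have <- : v = w by rewrite -(cp _ _ yw) yp pK.
    exact: porbit_trans a_on (porbit_step _ _).
  by rewrite -u'D //; apply: porbit_trans yw' (porbit_step _ _).
have fix' x : x \in off u -> x != a -> x != b -> u' x = x.
  move=> offx xa xb; rewrite u'D ?ufix //.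
  by apply: contraTneq offx => ->; apply: notoff.
have offE : off u' = off u :\: [set a; b].
  apply/setP=> x; rewrite in_setD in_set2 negb_or.
  have [->|xa] := eqVneq x a; first by rewrite inE ca a_on.
  have [->|xb] := eqVneq x b; first by rewrite inE cb b_on.
  rewrite /=; have [offx|] := boolP (x \in off u); last first.
    by rewrite !inE negbK => /on_on ->.
  rewrite inE porbit_sym; apply: contraL (offx).
  by move=> /(porbit_fixed (fix' _ offx xa xb)) <-.
split=> // x; rewrite offE in_setD in_set2 negb_or => /andP[/andP[xa xb] offx].
exact: fix'.
Qed.

(** Induction on the number of points outside the base cycles. Evenness provides a second such point
    in the class of any first one, and splicing in the pair keeps the parity in every class. *)
Lemma extend_to_classes u s :
    (forall x, c (u x) = c x) -> (forall x, x \in off u -> u x = x) ->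
    (forall v, ~~ odd #|[set x in off u | c x == v]|) ->
    single_cycle (u * s) ->
  exists u', [/\ forall x, c (u' x) = c x,
    forall x, x \in porbit u' (p (c x)) & single_cycle (u' * s)].
Proof.
have [m] := ubnP #|off u|; elim: m u => // m IHm u ltm cu ufix ueven u1.
have [off0 | [a offa]] := set_0Vmem (off u).
  by exists u; split=> // x; have := in_set0 x; rewrite -off0 inE => /negbFE.
pose O := [set x in off u | c x == c a].
have memO x : (x \in O) = (x \in off u) && (c x == c a) by rewrite in_set.
have aO : a \in O by rewrite memO offa eqxx.
have [b bOa] : exists b, b \in O :\ a.
  apply/set0Pn/negP => /eqP Oa0; have := ueven (c a).
  by rewrite -/O (cardsD1 a) aO Oa0 cards0.
have ab : a != b by move: bOa; rewrite in_setD1 eq_sym => /andP[].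
have [offb /eqP cb] : b \in off u /\ c b == c a.
  by move: bOa; rewrite in_setD1 memO => /and3P[_ -> ->].
(* The pair is kept in either order, since [single_cycle_3cycle] does not say which of the two
   3-cycles works. *)
have step a' b' : a' \in off u -> b' \in off u -> c a' = c a -> c b' = c a ->
    a' != b' -> single_cycle (tperm (p (c a)) a' * (tperm a' b' * (u * s))) ->
  exists u', [/\ forall x, c (u' x) = c x,
    forall x, x \in porbit u' (p (c x)) & single_cycle (u' * s)].
  move=> offa' offb' ca' cb' ab'.
  have [] := insert_3cycle cu ufix offa' offb' ca' cb' ab'.
  set u' := _ * _ => cu' off' ufix'.
  have sub_off : [set a'; b'] \subset off u by rewrite subUset !sub1set offa'.
  have -> : tperm (p (c a)) a' * (tperm a' b' * (u * s)) = u' * s.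
    by rewrite /u' !mulgA.
  move=> u'1; apply: (IHm u') => //.
    rewrite -ltnS; apply: leq_trans ltm; rewrite !ltnS off' cardsD.
    by rewrite (setIidPr sub_off) cards2 ab' (cardsD1 a') offa' add1n subSS ltnS leq_subr.
  move=> v; have := ueven v.
  have [->|vc] := eqVneq v (c a).
    have -> : [set x in off u' | c x == c a] = O :\: [set a'; b'].
      by rewrite off'; apply/setP=> x; rewrite !inE andbA.
    have subO : [set a'; b'] \subset O.
      by rewrite subUset !sub1set !memO offa' offb' ca' cb' eqxx.
    have := subset_leq_card subO; rewrite -/O cardsD (setIidPr subO) cards2 ab'.
    by move=> leO; rewrite oddB //= addbF.
  suff -> : [set x in off u' | c x == v] = [set x in off u | c x == v] by [].
  rewrite off'; apply/setP=> x; rewrite !inE -andbA.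
  have [cx|_] := eqVneq (c x) v; last by rewrite !andbF.
  have -> : x == a' = false by apply: contraNF vc => /eqP xa; rewrite -cx xa ca'.
  by have -> : x == b' = false by apply: contraNF vc => /eqP xb; rewrite -cx xb cb'.
have offn x : x \in off u -> p (c a) != x.
  by apply: contraTneq => <-; rewrite inE pK negbK porbit_id.
case: (single_cycle_3cycle (offn _ offa) (offn _ offb) ab u1) => H1.
- exact: (step a b).
- by apply: (step b a); rewrite // eq_sym.
Qed.

End Extension.

(** * Permutations read off cyclic sequences *)

Lemma porbitE s x y : (y \in porbit s x) = fconnect s x y.
Proof.
apply/porbitP/idP => [[i ->] | /iter_findex <-].
  by rewrite permX; apply: fconnect_iter.
by exists (findex s x y); rewrite permX.
Qed.

Definition next_perm (r : seq T) (Ur : uniq r) : {perm T} :=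
  perm (can_inj (prev_next Ur)).

Lemma next_permE r (Ur : uniq r) x : next_perm Ur x = next r x.
Proof. exact: permE. Qed.

Lemma next_perm_cycle r (Ur : uniq r) : fcycle (next_perm Ur) r.
Proof. by rewrite (eq_cycle (eq_frel (next_permE Ur))) cycle_next. Qed.

Lemma next_perm_single r (Ur : uniq r) :
  (forall x, x \in r) -> single_cycle (next_perm Ur).
Proof.
by move=> rT x y; rewrite porbitE (fconnect_cycle (next_perm_cycle Ur)).
Qed.

Lemma path_filter_porbit (t f : {perm T}) (P : pred T) x r :
    (forall z, ~~ P z -> f z = t z) -> fpath t x r ->
  path (fun a b => b \in porbit f (t a)) x (filter P r).
Proof.
move=> fD; elim: r x => //= y r IHr x /andP[/eqP txy /IHr{IHr} Pr].
have [Py /= | nPy] := ifPn; first by rewrite txy porbit_id Pr.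
case: (filter P r) Pr => //= z r' /andP[zy ->]; rewrite andbT txy.
by apply: porbit_trans (porbit_step _ _) _; rewrite fD.
Qed.

(** Outside [P] the map [f] agrees with [t]. Started at [t a], it therefore runs through the points
    removed by the filter until it reaches the next point of [P]. *)
Lemma cycle_filter_porbit (t f : {perm T}) (P : pred T) r :
    (forall z, ~~ P z -> f z = t z) -> fcycle t r ->
  path.cycle (fun a b => b \in porbit f (t a)) (filter P r).
Proof.
move=> fD; have [/hasP[x /path.splitPr[r1 r2] Px] | ] := boolP (has P r); last first.
  by rewrite has_filter negbK => /eqP ->.
(* Both cycles are rotated to start at a point of [P], which turns the claim into one about
   paths. *)
rewrite -(rot_cycle (size r1)) rot_size_cat filter_cat => /= tr.
rewrite -(rot_cycle (size (filter P r1))) rot_size_cat /= Px /= -filter_cat.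
by have := path_filter_porbit fD tr; rewrite filter_rcons Px.
Qed.

End Permutations.

(** * Transplanting an involution into a longer cycle *)

Section Transplant.
Variables (I T : finType) (phi : I -> T) (tau : I -> I).
Hypotheses (phi_inj : injective phi) (tauK : involutive tau).

Lemma involution_along : exists u : {perm T},
  (forall y, u (phi y) = phi (tau y)) /\ forall z, z \notin codom phi -> u z = z.
Proof.
pose h z := if [pick y | phi y == z] is Some y then phi (tau y) else z.
have hphi y : h (phi y) = phi (tau y).
  by rewrite /h; case: pickP => [y' /eqP/phi_inj -> // | /(_ y)]; rewrite eqxx.
have hD z : z \notin codom phi -> h z = z.
  rewrite /h; case: pickP => // y /eqP <-; rewrite codom_f //.
have hK : involutive h.
  move=> z; have [/codomP[y ->] | zD] := boolP (z \in codom phi).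
    by rewrite !hphi tauK.
  by rewrite !hD.
by exists (perm (inv_inj hK)); split=> [y | z zD]; rewrite permE ?hphi ?hD.
Qed.

(** Write [f] for the product. It sends [phi (tau y)] to the successor of [phi y] in [r], and from
    there follows [r] to [phi (next Y y)]. Membership in an orbit of [f] is thus a predicate on [I]
    that agrees at [tau y] and [next Y y], so the last hypothesis puts the whole image of [phi] into
    one orbit. *)
Lemma single_cycle_transplant (Y : seq I) (r : seq T) (Ur : uniq r)
    (u : {perm T}) :
    uniq Y -> (forall z, z \in r) -> (forall y, y \in Y) -> Y != [::] ->
    subseq (map phi Y) r ->
    (forall y, u (phi y) = phi (tau y)) ->
    (forall z, z \notin codom phi -> u z = z) ->
    (forall A : pred I, (forall y, A (tau y) = A (next Y y)) ->
       forall y z, A y -> A z) ->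
  single_cycle (u * next_perm Ur).
Proof.
move=> UY rT YI Y0 sub_r uphi uD HA; set t := next_perm Ur; set f := u * t.
have fD z : z \notin map phi Y -> f z = t z.
  move=> zY; rewrite permM uD //; apply: contra zY => /codomP[y ->].
  by rewrite map_f.
have := cycle_filter_porbit fD (next_perm_cycle Ur).
rewrite -(subseq_uniqP Ur sub_r) => cY.
have link y : phi (next Y y) \in porbit f (phi (tau y)).
  have := next_cycle cY (map_f phi (YI y)); rewrite next_map //.
  by apply: porbit_trans; rewrite -(tauK y) -uphi tauK -permM porbit_step.
have t1 : single_cycle t by apply: next_perm_single.
(* An orbit of [f] that misses the image of [phi] is closed under [t], hence contains everything,
   the image included. *)
have meets x : exists y, phi y \in porbit f x.
  apply/existsP; apply: contraT; rewrite negb_exists => /forallP nf.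
  have [i _] : exists i, i \in Y by case: (Y) Y0 => // i Y' _; exists i; rewrite mem_head.
  have /negP[] := nf i; move: (t1 x (phi i)).
  elim/(@porbit_ind _ t) => [|w _ fw]; first exact: porbit_id.
  rewrite -fD; first exact: porbit_trans fw (porbit_step _ _).
  by apply/mapP => -[y _ wy]; have := nf y; rewrite -wy fw.
move=> x z; have [y fxy] := meets x; have [y' fzy'] := meets z.
have fxy' : phi y' \in porbit f x.
  apply: (HA (fun y => phi y \in porbit f x)) fxy => y''.
  apply/idP/idP => h; first exact: porbit_trans h (link y'').
  by apply: porbit_trans h _; rewrite porbit_sym.
by apply: porbit_trans fxy' _; rewrite porbit_sym.
Qed.

End Transplant.

(** The two products are conjugate by [u]. *)
Lemma single_cycleC (T : finType) (s u : {perm T}) :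
  single_cycle (u * s) -> single_cycle (s * u).
Proof.
move=> us1 x y; rewrite -(permKV u x) -(permKV u y).
elim/(@porbit_ind _ (u * s)): (us1 (u^-1 x) (u^-1 y)) => [|z _ xz].
  exact: porbit_id.
by apply: porbit_trans xz _; rewrite [in X in X \in _]permM -permM porbit_step.
Qed.

Lemma involutions_connect_sym (T : finType) (f h : T -> T) :
    involutive f -> involutive h ->
  connect_sym (fun u v => (v == f u) || (v == h u)).
Proof.
move=> fK hK; apply: sym_connect_sym => u v.
by rewrite ![v == _]eq_sym (inv_eq fK) (inv_eq hK).
Qed.

Lemma alongK D : involutive (@along D).
Proof. by case=> [[a e] s]; rewrite /along negbK. Qed.

Lemma acrossK D : involutive (@across D).
Proof. by case=> [[a e] s]; rewrite /across negbK. Qed.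

Lemma euler_next_tail D (X : seq (darc D)) a :
  directed_euler_circuit X -> dtail (next X a) = dhead a.
Proof.
by case=> -[_ cX] _ XD _; have /eqP -> := next_cycle cX (XD a).
Qed.

(** * The embedding built from two complementary euler circuits *)

Section TwoCircuits.
Variables (D : digraph) (W : seq (darc D)) (W_euler : directed_euler_circuit W).
Variables (UW : uniq W) (pi : {perm darc D}).
Let t := next_perm UW.
Hypothesis pi_tail : forall a, dtail (pi a) = dtail a.
Hypothesis pi_class : forall a b, dtail a = dtail b -> b \in porbit pi a.
Hypothesis pit_single : single_cycle (pi * t).

Lemma euler_mem (a : darc D) : a \in W.
Proof. by case: W_euler. Qed.

Lemma next_perm_tail (a : darc D) : dtail (t a) = dhead a.
Proof. by rewrite next_permE (euler_next_tail _ W_euler). Qed.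

Lemma euler_out_arc (v : dvert D) : exists a : darc D, dtail a = v.
Proof. by case: W_euler => _ _ _ /(_ v) /mapP[a _ ->]; exists a. Qed.

(** Successor of an arc along the face on side [s]: the given circuit for [true], the complementary
    one for [false]. *)
Definition turn (s : bool) : {perm darc D} := if s then t else t * pi.

Lemma turn_single s : single_cycle (turn s).
Proof.
by case: s; [apply: next_perm_single; apply: euler_mem | apply: single_cycleC].
Qed.

Lemma turn_tail s a : dtail (turn s a) = dhead a.
Proof. by case: s; rewrite /= ?permM ?pi_tail next_perm_tail. Qed.

(** On side [s] the head of [a] is glued to the tail of [turn s a], so that [face_step] acts as
    [turn s] on tail flags. *)
Definition turn_corner (x : flag D) : flag D :=
  let: (a, e, s) := x in
  if e then ((turn s)^-1 a, false, s) else (turn s a, true, s).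

Lemma turn_cornerK : involutive turn_corner.
Proof. by case=> [[a []] s] /=; rewrite ?permK ?permKV. Qed.

Lemma turn_corner_neq x : turn_corner x <> x.
Proof. by case: x => [[a []] s] []. Qed.

Lemma turn_corner_vert x : flag_vert (turn_corner x) = flag_vert x.
Proof.
case: x => [[a []] s]; rewrite /flag_vert /=; last exact: turn_tail.
by rewrite -(turn_tail s) permKV.
Qed.

(** From the tail flag of [c] on side [true], the moves corner, across, corner, across lead to the
    tail flag of [pi c] on the same side. The rotation at a vertex therefore runs through a whole
    cycle of [pi], which contains all arcs leaving that vertex. *)
Lemma turn_corner_single x y : flag_vert x = flag_vert y ->
  connect (fun u v => (v == turn_corner u) || (v == across u)) x y.
Proof.
set R := fun u v => _; have Rcorner u : connect R u (turn_corner u).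
  by apply: connect1; rewrite /R eqxx.
have Racross u : connect R u (across u).
  by apply: connect1; rewrite /R eqxx orbT.
have R_sym : connect_sym R.
  exact: involutions_connect_sym turn_cornerK (@acrossK D).
have root z : exists2 b, dtail b = flag_vert z & connect R z (b, true, true).
  have [b bz Rzb] : exists2 b : darc D * bool,
      dtail b.1 = flag_vert z & connect R z (b.1, true, b.2).
    case: z => [[a []] s]; first by exists (a, s).
    by exists (turn s a, s); [apply: turn_tail | apply: Rcorner].
  exists b.1 => //; apply: connect_trans Rzb _; case: b {bz} => a [] /=.
    exact: connect0.
  exact: Racross (a, true, false).
move=> xy; have [a ax Ra] := root x; have [b bx Rb] := root y.
apply: connect_trans Ra _; rewrite R_sym; apply: connect_trans Rb _; rewrite R_sym.
have : b \in porbit pi a by apply: pi_class; rewrite ax bx.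
elim/(@porbit_ind _ pi) => // c _ Rc; apply: connect_trans Rc _.
have := Rcorner (c, true, true); move/connect_trans; apply.
have := Racross (t^-1 c, false, true); move/connect_trans; apply.
have := Rcorner (t^-1 c, false, false); rewrite /= permM permKV.
by move/connect_trans; apply; apply: Racross.
Qed.

Lemma euler_connected : connected_digraph D.
Proof.
move=> v w; have [a <-] := euler_out_arc v; have [b <-] := euler_out_arc w.
elim/(@porbit_ind _ t): (turn_single true a b) => // c _ ac.
apply: connect_trans ac (connect1 _); apply/existsP; exists c.
by rewrite next_perm_tail !eqxx.
Qed.

Definition two_circuit_embedding : embedding D :=
  Embedding turn_cornerK turn_corner_neq turn_corner_vert turn_corner_single
    euler_connected.
Let E := two_circuit_embedding.

(** Neither [turn_corner] nor [along] changes the side. Conversely, all flags of a side are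
    connected because [turn s] is a single cycle. *)
Lemma face_of_side x : face_of E x = [set y | y.2 == x.2].
Proof.
apply/setP=> y; rewrite !inE; set R := fun u v => _.
have Rcorner u : connect R u (turn_corner u).
  by apply: connect1; rewrite /R eqxx.
have Ralong u : connect R u (along u).
  by apply: connect1; rewrite /R eqxx orbT.
apply/idP/eqP => [xy | yx].
  have R_closed : closed R [pred z | z.2 == x.2].
    by move=> [[a e] s] v /orP[] /eqP-> //; case: e.
  by have := closed_connect R_closed xy; rewrite !inE eqxx => /esym/eqP.
move: x y yx => [[a e] s] [[b e'] _] /= ->.
have Rstep c : connect R (c, true, s) (turn s c, true, s).
  by apply: connect_trans (Ralong (c, true, s)) (Rcorner (c, false, s)).
have Rall : connect R (a, true, s) (b, true, s).
  elim/(@porbit_ind _ (turn s)): (turn_single s a b) => // c _ ac.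
  exact: connect_trans ac (Rstep c).
have Rab : connect R (a, e, s) (b, true, s).
  by case: e => //; apply: connect_trans (Ralong (a, false, s)) Rall.
by case: e' => //; apply: connect_trans Rab (Ralong (b, true, s)).
Qed.

Lemma bounded_by_turn s (X : seq (darc D)) : X <> [::] -> uniq X ->
  fcycle (turn s) X -> bounded_by E [set y : flag D | y.2 == s] X.
Proof.
case: X => // a X _ UX cX; pose i (b : darc D) : flag D := (b, true, s).
have i_inj : injective i by move=> b c [].
have ci : fcycle (face_step E) (map i (a :: X)).
  rewrite /= -map_rcons path_map; apply: sub_path cX => b c /eqP <- /=.
  exact: eqxx.
have [k ok] := orbit_rot_cycle ci (etrans (map_inj_uniq i_inj _) UX)
  (map_f i (mem_head a X)).
exists (i a); rewrite ok; split; first by rewrite inE.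
  by apply/allP=> y; rewrite mem_rot => /mapP[b _ ->].
rewrite -map_rot -map_comp map_id_in //.
(* The orbit is [X] rotated by [k], and the witness undoes that rotation. *)
by exists (size (rot k (a :: X)) - k)%N; rewrite -/(rotr _ _) rotK.
Qed.

Lemma two_circuit_bi_eulerian :
  [/\ bi_eulerian E, orientable E
    & exists F : {set flag D}, F \in faces E /\ bounded_by E F W].
Proof.
have [[W0 cW] _ WD WV] := W_euler.
have [a0 W_a0] : exists a, a \in W.
  by case: (W) W0 => // a W' _; exists a; rewrite mem_head.
pose side s := [set y : flag D | y.2 == s].
have facesE : faces E = [set side true; side false].
  apply/setP=> F; rewrite !inE; apply/imsetP/orP => [[x _ ->] | ].
    by rewrite face_of_side; case: x => [[a e] []]; [left | right].
  by case=> /eqP->; [exists (a0, true, true) | exists (a0, true, false)];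
    rewrite // face_of_side.
have bd F : F \in faces E ->
    exists X, directed_euler_circuit X /\ bounded_by E F X.
  rewrite facesE => FE; have [s ->] : exists s, F = side s.
    by case/set2P: FE => ->; [exists true | exists false].
  pose X := fingraph.orbit (turn s) a0.
  have XD a : a \in X by rewrite -fconnect_orbit -porbitE turn_single.
  have X0 : X <> [::] by move=> X0; have := XD a0; rewrite X0.
  have cX : fcycle (turn s) X by apply/cycle_orbit/perm_inj.
  exists X; split; last by apply: bounded_by_turn; rewrite ?orbit_uniq.
  split=> //; last 1 [by move=> v; have [a <-] := euler_out_arc v; rewrite map_f].
  - split=> //; apply: sub_cycle cX => a b /eqP <-; apply/eqP.
    by rewrite turn_tail.
  - exact: orbit_uniq.
split.
- split=> // [F /bd[X [[cX _ _ _] FX]]|]; first by exists X.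
  rewrite facesE cards2; case: eqP => // /setP/(_ (a0, true, true)).
  by rewrite !inE.
(* Corners and [along] change only the end of the arc in this sum, and [across] only the side. *)
- by exists (fun x => x.1.2 (+) x.2) => -[[a []] []].
- exists (side true); split; first by rewrite facesE set21.
  by apply: bounded_by_turn => //; apply: next_perm_cycle.
Qed.

End TwoCircuits.

Lemma map_uniq_inj (T1 T2 : eqType) (f : T1 -> T2) r :
  uniq (map f r) -> {in r &, injective f}.
Proof.
elim: r => // a r IHr /= /andP[fa /IHr inj] x y; rewrite !inE.
move=> /predU1P[->|xr] /predU1P[->|yr] // fxy; last exact: inj.
  by case/negP: fa; rewrite fxy map_f.
by case/negP: fa; rewrite -fxy map_f.
Qed.

(** * The two facial circuits of a bi-eulerian embedding *)

Section Faces.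
Variables (D : digraph) (E : embedding D).

Lemma face_step_inj : injective (face_step E).
Proof.
exact: inj_comp (inv_inj (@corner_invol _ E)) (inv_inj (@alongK D)).
Qed.

Lemma face_eq (F : {set flag D}) x : F \in faces E -> x \in F -> F = face_of E x.
Proof.
case/imsetP=> y _ ->; rewrite inE => xy; apply/setP=> z; rewrite !inE.
exact: same_connect (involutions_connect_sym (@corner_invol _ E) (@alongK D)) _ _ xy _.
Qed.

(** A boundary that is an euler circuit passes each arc exactly once, so it determines one side of
    each arc. Its face steps, read on these sides, are the successions of [X]. *)
Lemma boundary_side (F : {set flag D}) (X : seq (darc D)) :
    F \in faces E -> directed_euler_circuit X -> bounded_by E F X ->
  exists side : darc D -> bool,
    (forall a, (a, true, side a) \in F) /\
    (forall a, corner E (a, false, side a) = (next X a, true, side (next X a))).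
Proof.
move=> FE [_ UX XD _] [x [xF tailO [k XO]]].
pose O := fingraph.orbit (face_step E) x; rewrite -/O in tailO XO.
pose Y := map (@flag_arc D) O; rewrite -/Y in XO.
have UY : uniq Y by rewrite -(rot_uniq k) -XO.
have YD a : a \in Y by rewrite -(mem_rot k) -XO.
have /fin_all_exists[side sideO] a : exists s, (a, true, s) \in O.
  have /mapP[[[b e] s] bO ->] := YD a; exists s.
  by have /= := allP tailO _ bO; case: e bO.
pose i a : flag D := (a, true, side a).
(* No arc repeats along the orbit, so each flag in it is the one recorded by [side] for its arc. *)
have OY : O = map i Y.
  rewrite -map_comp map_id_in // => z zO /=.
  exact: (map_uniq_inj UY) (sideO _) zO _.
have i_inj : injective i by move=> a b [].
exists side; split=> a.
  rewrite (face_eq FE xF) inE; move: (sideO a); rewrite -fconnect_orbit.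
  apply: connect_sub => y z /eqP <-.
  apply: (@connect_trans _ _ (along y)); apply: connect1.
    by rewrite eqxx orbT.
  by rewrite eqxx.
have /eqP := next_cycle (cycle_orbit face_step_inj x) (sideO a).
rewrite -/O OY (next_map i_inj UY) XO (next_rot k UY).
by [].
Qed.

End Faces.

Lemma other_out_arc (H : digraph) : four_regular H ->
  exists tau : darc H -> darc H,
    [/\ involutive tau, forall a, tau a != a, forall a, dtail (tau a) = dtail a
      & forall a b, dtail a = dtail b -> b = a \/ b = tau a].
Proof.
move=> H4.
have /fin_all_exists[tau tauE] (a : darc H) : exists b,
    [set b | dtail b == dtail a] :\ a = [set b].
  apply/cards1P; have [/eqP] := H4 (dtail a).
  by rewrite /outdeg (cardsD1 a) inE eqxx.
have tauP a b : (b == tau a) = (b != a) && (dtail b == dtail a).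
  by have /setP/(_ b) := tauE a; rewrite !inE.
have tau_neq a : tau a != a by have := tauP a (tau a); rewrite eqxx => /esym/andP[].
have tau_tail a : dtail (tau a) = dtail a.
  by have := tauP a (tau a); rewrite eqxx => /esym/andP[_ /eqP].
exists tau; split=> // [a | a b ab].
  by apply/esym/eqP; rewrite tauP eq_sym tau_neq tau_tail eqxx.
by apply/pred2P; rewrite /= tauP ab eqxx andbT; case: eqP.
Qed.

(** Both successors of [a] leave the head of [a]. If they were the same arc [b], both corners at the
    head of [a] would lead to the tail of [b], and these two arc ends would form a complete rotation
    that leaves out [tau b]. *)
Lemma two_faces_next (H : digraph) (E : embedding H) (F1 F2 : {set flag H})
    (X1 X2 : seq (darc H)) (tau : darc H -> darc H) :
    faces E = [set F1; F2] -> F1 <> F2 ->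
    directed_euler_circuit X1 -> directed_euler_circuit X2 ->
    bounded_by E F1 X1 -> bounded_by E F2 X2 ->
    (forall a, tau a != a) -> (forall a, dtail (tau a) = dtail a) ->
    (forall a b, dtail a = dtail b -> b = a \/ b = tau a) ->
  forall a, next X2 a = tau (next X1 a).
Proof.
move=> EF F12 X1e X2e b1 b2 tau_neq tau_tail tau_out a.
have FE1 : F1 \in faces E by rewrite EF set21.
have FE2 : F2 \in faces E by rewrite EF set22.
have [s1 [F1s next1]] := boundary_side FE1 X1e b1.
have [s2 [F2s next2]] := boundary_side FE2 X2e b2.
(* The two faces lie on opposite sides of every arc, since a common flag would make them equal. *)
have s12 b : s2 b = ~~ s1 b.
  have : s1 b != s2 b; last by case: (s1 b) (s2 b) => -[].
  apply: contra_not_neq F12 => sb.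
  by rewrite (face_eq FE1 (F1s b)) (face_eq FE2 (F2s b)) sb.
have tail12 : dtail (next X1 a) = dtail (next X2 a).
  by rewrite !euler_next_tail.
case: (tau_out _ _ tail12) => // nextE.
set b := next X1 a in next1 next2 nextE *.
have corner_a s : (corner E (a, false, s)).1 = (b, true).
  have [->|->] : s = s1 a \/ s = s2 a; rewrite ?s12.
  - by case: s (s1 a) => -[]; [left | right | right | left].
  - by rewrite next1.
  by rewrite -s12 next2 nextE.
have corner_b s : (corner E (b, true, s)).1 = (a, false).
  have [->|->] : s = s1 b \/ s = s2 b; rewrite ?s12.
  - by case: s (s1 b) => -[]; [left | right | right | left].
  - by rewrite -next1 corner_invol.
  by rewrite -s12 -{1}nextE -{1}nextE -next2 corner_invol.
(* The four flags at the head of [a] and the tail of [b], closed under corners and [across]. *)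
pose Z := [pred z : flag H | (z.1 == (a, false)) || (z.1 == (b, true))].
have Z_closed : closed (fun u v => (v == corner E u) || (v == across u)) Z.
  apply: intro_closed => [|u v uv].
    exact: involutions_connect_sym (@corner_invol _ E) (@acrossK H).
  case: u uv => [[c e] s] uv /orP[] /= /eqP[? ?]; subst c e.
    by case/orP: uv => /eqP ->; rewrite inE /= ?corner_a ?eqxx ?orbT.
  by case/orP: uv => /eqP ->; rewrite inE /= ?corner_b ?eqxx ?orbT.
have ab : flag_vert ((a, false, true) : flag H) = flag_vert ((tau b, true, true) : flag H).
  by rewrite /flag_vert /= tau_tail /b euler_next_tail.
have := closed_connect Z_closed (corner_single E ab).
rewrite !inE /= !xpair_eqE !eqxx => /esym/orP[]/andP[] //.
by rewrite (negPf (tau_neq b)).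
Qed.

(** * Invariant predicates along the pattern *)

Lemma next_invariant (I : finType) (X : seq I) (B : pred I) :
    uniq X -> (forall x, x \in X) -> (forall y, B y = B (next X y)) ->
  forall y z, B y = B z.
Proof.
move=> UX XI BX y z.
elim/(@porbit_ind _ (next_perm UX)): (next_perm_single UX XI y z) => // x _ ->.
by rewrite next_permE.
Qed.

(* Joining [tau y] to the successor of [y] amounts to following [X'],
   up to relabelling by [tau] when [Y] is [X] rather than its reverse. *)
Lemma pattern_invariant (I : finType) (X X' Y : seq I) (tau : I -> I) k :
    uniq X -> uniq X' -> (forall x, x \in X') ->
    involutive tau -> (forall y, next X' y = tau (next X y)) ->
    Y = rot k X \/ Y = rot k (rev X) ->
  forall A : pred I, (forall y, A (tau y) = A (next Y y)) ->
    forall y z, A y -> A z.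
Proof.
move=> UX UX' X'I tauK X'E [->|->] A AY y z.
  have AX' w : A (tau w) = A (tau (next X' w)).
    by rewrite AY next_rot // X'E tauK.
  have := next_invariant (B := A \o tau) UX' X'I AX' (tau y) (tau z).
  by rewrite /= !tauK => ->.
have AX' w : A w = A (next X' w).
  by rewrite X'E AY next_rot ?rev_uniq // next_rev // prev_next.
by rewrite (next_invariant UX' X'I AX' y z).
Qed.

(** Each position of [xi] stands for an arc of [H] with that tail. Listing these arcs in the order
    of [gamma] gives [Y], a rotation of [X] or of its reverse. The relabelling is injective on all
    vertices because [X] visits them all. *)
Lemma patterned_arcs (H : digraph) (X X' : seq (darc H)) (tau : darc H -> darc H)
    (U : eqType) (gamma : seq U) (xi : seq (dvert H)) :
    directed_euler_circuit X -> directed_euler_circuit X' ->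
    involutive tau -> (forall y, next X' y = tau (next X y)) ->
    xi = vertex_seq X \/ xi = rev (vertex_seq X) -> patterned_by gamma xi ->
  exists (Y : seq (darc H)) (g : dvert H -> U),
    [/\ uniq Y /\ (forall y, y \in Y), Y != [::], injective g,
        gamma = map (g \o @dtail H) Y
      & forall A : pred (darc H), (forall y, A (tau y) = A (next Y y)) ->
          forall y z, A y -> A z].
Proof.
move=> [[X0 _] UX XI XV] [_ UX' X'I _] tauK X'E xiX [_ _ [g [g_inj _ [k gammaE]]]].
have [Z [ZX xiE]] : exists Z, (Z = X \/ Z = rev X) /\ xi = vertex_seq Z.
  by case: xiX => ->; [exists X | exists (rev X)]; rewrite /vertex_seq ?map_rev; auto.
exists (rot k Z), g; split.
- by case: ZX => ->; split=> [|y]; rewrite ?rot_uniq ?rev_uniq ?mem_rot ?mem_rev.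
- rewrite -size_eq0 size_rot; have -> : size Z = size X.
    by case: ZX => ->; rewrite ?size_rev.
  by rewrite size_eq0; apply/eqP.
- have xiV v : v \in xi by case: xiX => ->; rewrite ?mem_rev.
  by move=> v w; apply: g_inj.
- by rewrite gammaE xiE /vertex_seq -map_comp map_rot.
- apply: (pattern_invariant UX UX' X'I tauK X'E (k := k)).
  by case: ZX => ->; auto.
Qed.

(** * The complementary circuit in D *)

(** Succession along [T] matches the arcs entering [v] with those leaving it, so the degree is twice
    the outdegree. *)
Lemma euler_degree (D : digraph) (T : seq (darc D)) v :
  directed_euler_circuit T -> (v \in mod4_vertices D) = ~~ odd (outdeg v).
Proof.
move=> Te; have [_ UT _ _] := Te.
have indegE : indeg v = outdeg v.
  rewrite /outdeg -(card_preimset _ (@perm_inj _ (next_perm UT))) /indeg.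
  by apply: eq_card => a; rewrite !inE next_permE (euler_next_tail _ Te).
rewrite inE /degree indegE addnn -muln2 -(muln_modl 2 _ 2) mod0n muln_eq0 orbF.
by rewrite modn2 eqb0.
Qed.

(** The starting permutation [u] swaps the two arcs selected by [gamma] at each vertex of S and
    fixes the other arcs. It is [tau] carried over from [H], so its product with [T] is a single
    cycle, and it is then extended to full classes of arcs with a common tail. *)
Lemma complementary_circuit (D : digraph) (T : seq (darc D)) (UT : uniq T)
    (gamma : seq (dvert D)) (H : digraph) (tau : darc H -> darc H)
    (Y : seq (darc H)) (g : dvert H -> dvert D) :
    directed_euler_circuit T ->
    cyclic_subseq gamma (vertex_seq T) ->
    (forall v, (v \in gamma) = (v \in mod4_vertices D)) ->
    involutive tau -> (forall a, tau a != a) ->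
    (forall a, dtail (tau a) = dtail a) ->
    (forall a b, dtail a = dtail b -> b = a \/ b = tau a) ->
    uniq Y -> (forall y, y \in Y) -> Y != [::] -> injective g ->
    gamma = map (g \o @dtail H) Y ->
    (forall A : pred (darc H), (forall y, A (tau y) = A (next Y y)) ->
       forall y z, A y -> A z) ->
  exists pi : {perm darc D},
    [/\ forall a, dtail (pi a) = dtail a,
        forall a b, dtail a = dtail b -> b \in porbit pi a
      & single_cycle (pi * next_perm UT)].
Proof.
move=> Te [k /subseqP[m _ gammaA]] gammaS tauK tau_neq tau_tail tau_out UY YH Y0 g_inj gammaE HA.
have [_ _ TD _] := Te.
rewrite /vertex_seq -map_rot -map_mask in gammaA.
set r := rot k T in gammaA; set A := mask m r in gammaA.
have Ur : uniq r by rewrite rot_uniq.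
have rD a : a \in r by rewrite mem_rot.
have sub_A : subseq A r by apply: mask_subseq.
have UA : uniq A by apply: subseq_uniq sub_A Ur.
have sizeA : size A = size Y.
  by rewrite -(size_map (g \o @dtail H) Y) -gammaE gammaA size_map.
have y0 : darc H by case: (Y) Y0.
have a0 : darc D by case: (A) sizeA Y0 => // /esym/size0nil ->.
(* The arc of [D] at the position of [gamma] that corresponds to [y]. *)
pose phi y := nth a0 A (index y Y).
have ltA y : index y Y < size A by rewrite sizeA index_mem.
have phi_inj : injective phi.
  move=> y z /eqP; rewrite nth_uniq // => /eqP yz.
  by rewrite -(nth_index y (YH y)) yz nth_index.
have phiY : map phi Y = A.
  apply: (@eq_from_nth _ a0) => [|i]; rewrite size_map // => ltY.
  by rewrite (nth_map y0) // /phi index_uniq.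
have phi_tail y : dtail (phi y) = g (dtail y).
  have v0 := g (dtail y0).
  rewrite -(nth_map a0 v0) // -gammaA gammaE (nth_map y0) ?index_mem //=.
  by rewrite nth_index.
have phiS y : dtail (phi y) \in mod4_vertices D.
  by rewrite phi_tail -gammaS gammaE (map_f (g \o @dtail H)).
have [u [uphi uD]] := involution_along phi_inj tauK.
have u_single : single_cycle (u * next_perm UT).
  have -> : next_perm UT = next_perm Ur.
    by apply/permP=> a; rewrite !next_permE next_rot.
  apply: (single_cycle_transplant phi_inj tauK Ur UY rD YH Y0 _ uphi uD HA).
  by rewrite phiY.
have u_tail a : dtail (u a) = dtail a.
  have [/codomP[y ->]|/uD -> //] := boolP (a \in codom phi).
  by rewrite uphi !phi_tail tau_tail.
(* At a vertex of S the base arc must be a selected one, so that its cycle under [u] is the pair of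
   selected arcs; elsewhere any outgoing arc serves. *)
have /fin_all_exists[p pP] v : exists a : darc D,
    dtail a = v /\ (v \in mod4_vertices D -> a \in codom phi).
  have [vS|_] := boolP (v \in mod4_vertices D); last first.
    by have [a <-] := euler_out_arc Te v; exists a.
  move: vS; rewrite -gammaS gammaE => /mapP[y _ ->].
  by exists (phi y); rewrite phi_tail codom_f.
have pK : cancel p (@dtail D) by move=> v; case: (pP v).
have orbit_phi y z : (z \in porbit u (phi y)) = (z \in [set phi y; phi (tau y)]).
  apply/idP/set2P => [|[]->]; last 2 first.
  - exact: porbit_id.
  - by rewrite -uphi porbit_step.
  elim/(@porbit_ind _ u) => [|w _ [->|->]]; first by left.
  - by rewrite uphi; right.
  - by rewrite uphi tauK; left.
have p_codom v : (p v \in codom phi) = (v \in mod4_vertices D).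
  apply/idP/idP; last by case: (pP v).
  by move=> /codomP[y pv]; rewrite -(pK v) pv.
have off_fixed x : x \in off (@dtail D) p u -> u x = x.
  have [/codomP[y ->]|/uD -> //] := boolP (x \in codom phi).
  have /codomP[y' py'] : p (dtail (phi y)) \in codom phi by rewrite p_codom.
  have : dtail y' = dtail y by apply: g_inj; rewrite -!phi_tail -py' pK.
  rewrite inE py' orbit_phi => /tau_out[] ->; first by rewrite set21.
  by rewrite set22.
(* The base cycle has two arcs where the outdegree is even and one where it is odd, so an even
   number of arcs remains at every vertex. *)
have off_even v : ~~ odd #|[set x in off (@dtail D) p u | dtail x == v]|.
  have -> : [set x in off (@dtail D) p u | dtail x == v] =
            [set x | dtail x == v] :\: porbit u (p v).
    apply/setP=> x; rewrite !inE andbC [in RHS]andbC.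
    by have [->|] := eqVneq (dtail x) v.
  have sub_out : porbit u (p v) \subset [set x | dtail x == v].
    apply/subsetP=> x; rewrite inE.
    by elim/(@porbit_ind _ u) => [|w _]; rewrite ?pK ?u_tail.
  rewrite cardsD (setIidPr sub_out) oddB ?subset_leq_card // -/(outdeg v).
  rewrite -[odd (outdeg v)]negbK -(euler_degree v Te) -p_codom.
  have [/codomP[y ->] | pv] := boolP (p v \in codom phi).
    have -> : porbit u (phi y) = [set phi y; phi (tau y)] by apply/setP/orbit_phi.
    by rewrite cards2 (inj_eq phi_inj) eq_sym tau_neq.
  have -> : porbit u (p v) = [set p v]; last by rewrite cards1.
  apply/setP=> x; rewrite inE; apply/idP/eqP => [|->]; last exact: porbit_id.
  exact: porbit_fixed (uD _ pv).
have [pi [pi_tail pi_class pi1]] := extend_to_classes pK u_tail off_fixed off_even u_single.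
exists pi; split=> // a b ab.
by apply: porbit_trans (pi_class b); rewrite -ab porbit_sym.
Qed.

Theorem theorem4p16 (D : digraph) (n : nat)
    (D_eulerian : eulerian D)
    (card_S : #|mod4_vertices D| = (2 * n)%N)
    (H : digraph)
    (H_regular : four_regular H)
    (card_H : #|dvert H| = (2 * n)%N)
    (EH : embedding H)
    (EH_bi_eulerian : bi_eulerian EH)
    (X1 X2 : seq (darc H))
    (X1_euler : directed_euler_circuit X1)
    (X2_euler : directed_euler_circuit X2)
    (EH_faces : exists F1 F2 : {set flag H},
       [/\ faces EH = [set F1; F2], F1 <> F2,
           bounded_by EH F1 X1 & bounded_by EH F2 X2])
    (T : seq (darc D))
    (T_euler : directed_euler_circuit T)
    (gamma : seq (dvert D))
    (gamma_sub : cyclic_subseq gamma (vertex_seq T))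
    (gamma_twice : forall v : dvert D,
       count_mem v gamma = if v \in mod4_vertices D then 2 else 0)
    (gamma_patterned : exists xi : seq (dvert H),
       xi \in [:: vertex_seq X1; vertex_seq X2;
                  rev (vertex_seq X1); rev (vertex_seq X2)]
       /\ patterned_by gamma xi) :
  exists E : embedding D,
    [/\ bi_eulerian E, orientable E
      & exists F : {set flag D}, F \in faces E /\ bounded_by E F T].
Proof.
have [tau [tauK tau_neq tau_tail tau_out]] := other_out_arc H_regular.
have [F1 [F2 [EF F12 b1 b2]]] := EH_faces.
have X2E := two_faces_next EF F12 X1_euler X2_euler b1 b2 tau_neq tau_tail tau_out.
have X1E a : next X1 a = tau (next X2 a) by rewrite X2E tauK.
have [xi [xi_in xi_pat]] := gamma_patterned.
have [Y [g [[UY YH] Y0 g_inj gammaE HA]]] :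
    exists (Y : seq (darc H)) (g : dvert H -> dvert D),
    [/\ uniq Y /\ (forall y, y \in Y), Y != [::], injective g,
        gamma = map (g \o @dtail H) Y
      & forall A : pred (darc H), (forall y, A (tau y) = A (next Y y)) ->
          forall y z, A y -> A z].
  (* The circuits [X1] and [X2] play symmetric roles because [tau] is an involution. *)
  have /orP[] : (xi \in [:: vertex_seq X1; rev (vertex_seq X1)])
             || (xi \in [:: vertex_seq X2; rev (vertex_seq X2)]).
  - by move: xi_in; rewrite !inE -!orbA => /or4P[] ->; rewrite ?orbT.
  - rewrite !inE => /pred2P xiX.
    exact: patterned_arcs X1_euler X2_euler tauK X2E xiX xi_pat.
  - rewrite !inE => /pred2P xiX.
    exact: patterned_arcs X2_euler X1_euler tauK X1E xiX xi_pat.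
have [_ UT _ _] := T_euler.
have gammaS v : (v \in gamma) = (v \in mod4_vertices D).
  by rewrite -has_pred1 has_count gamma_twice; case: ifP.
have [pi [pi_tail pi_class pi1]] := complementary_circuit UT T_euler gamma_sub
  gammaS tauK tau_neq tau_tail tau_out UY YH Y0 g_inj gammaE HA.
exists (two_circuit_embedding T_euler pi_tail pi_class pi1).
exact: two_circuit_bi_eulerian.
Qed.
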